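(* There is a constant $C$ such that for all integers $l\ge2$ and $i\le l$ (with $N^l_i$ defined), $K(N^i\mid N^l_i)\le C\log l$ and $K(N^l_i\mid N^i)\le C\log l$.
   Context: $K$ is prefix Kolmogorov complexity w.r.t. a fixed reference universal prefix machine. For an integer $l$, $N^l$ denotes the number of binary strings $y$ with $K(y)\le l$, $|N^l|$ the length of the binary notation of $N^l$, and for $i\le|N^l|$, $N^l_i$ denotes the $i$ most significant bits of the binary notation of $N^l$. *)

(* Defs.v *)
(* MathComp sequences and classical sets; the real logarithm is Stdlib's. *)
From Stdlib Require Export Rdefinitions Raxioms Rpower.
From Stdlib Require Import Cantor.
From mathcomp Require Export all_boot.
From mathcomp Require Import finmap boolp classical_sets cardinality.

Set Implicit Arguments.
Unset Strict Implicit.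
Unset Printing Implicit Defensive.

(* MathComp delimits its own ring_scope with %R. *)
Delimit Scope R_scope with coqR.

(* Kleene's partial recursive functions, presented with one argument over the
   Cantor pairing [Cantor.to_nat : nat * nat -> nat]. *)
Inductive code : Type :=
| CZero
| CSucc
| CLeft
| CRight
| CPair of code & code
| CComp of code & code
| CPrec of code & code
| CMu of code.

(* [eval c n m]: the partial function computed by [c] is defined at [n], with
   value [m].  The recursion scheme is h(a, 0) = f a and
   h(a, k+1) = g(a, (k, h(a, k))); minimization returns the least m such that
   f(n, m) = 0, f(n, k) being defined and positive for all k < m. *)
Inductive eval : code -> nat -> nat -> Prop :=
| EvalZero n : eval CZero n 0
| EvalSucc n : eval CSucc n n.+1
| EvalLeft n : eval CLeft n (Cantor.of_nat n).1
| EvalRight n : eval CRight n (Cantor.of_nat n).2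
| EvalPair f g n a b :
    eval f n a -> eval g n b -> eval (CPair f g) n (Cantor.to_nat (a, b))
| EvalComp f g n a m :
    eval g n a -> eval f a m -> eval (CComp f g) n m
| EvalPrec0 f g a m :
    eval f a m -> eval (CPrec f g) (Cantor.to_nat (a, 0)) m
| EvalPrecS f g a k r m :
    eval (CPrec f g) (Cantor.to_nat (a, k)) r ->
    eval g (Cantor.to_nat (a, Cantor.to_nat (k, r))) m ->
    eval (CPrec f g) (Cantor.to_nat (a, k.+1)) m
| EvalMu f n m (v : nat -> nat) :
    (forall k, k < m -> eval f (Cantor.to_nat (n, k)) (v k).+1) ->
    eval f (Cantor.to_nat (n, m)) 0 ->
    eval (CMu f) n m.

(* Binary strings are identified with natural numbers by bijective base-2
   numeration: [:: b0; b1; ...] |-> (b0 + 1) + 2 (b1 + 1) + 4 (b2 + 1) + ... *)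
Definition num_of_string (s : seq bool) : nat :=
  foldr (fun (b : bool) n => n.*2 + b.+1) 0 s.

(* [run M p y x]: the machine [M], on program [p] with condition [y], halts
   with output [x]. *)
Definition run (M : code) (p y x : seq bool) : Prop :=
  eval M (Cantor.to_nat (num_of_string p, num_of_string y)) (num_of_string x).

Definition halts (M : code) (p y : seq bool) : Prop := exists x, run M p y x.

Definition prefix_machine (M : code) : Prop :=
  forall y p q, halts M p y -> halts M q y -> prefix p q -> p = q.

Definition universal_prefix_machine (U : code) : Prop :=
  prefix_machine U /\
  forall M, prefix_machine M ->
    exists e, forall p y x, run U (e ++ p) y x <-> run M p y x.

(* Conditional complexity K(x | y): the length of a shortest program.  The
   value 0 in the absence of programs is a dummy, never reached when [U] is
   universal. *)
Definition KC (U : code) (x y : seq bool) : nat :=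
  if pselect (exists k, `[< exists2 p, size p = k & run U p y x >]) is left h
  then ex_minn h else 0.

Definition KC0 (U : code) (x : seq bool) : nat := KC U x [::].

(* N^l.  [fset_set] is the empty set on infinite sets, but the set below is
   finite when [U] is universal. *)
Definition Ncount (U : code) (l : nat) : nat :=
  (#|` fset_set [set y : seq bool | KC0 U y <= l]%classic |)%fset.

(* Binary notation, most significant bit first, without leading zeros except
   that 0 is written [:: false]. *)
Definition binary (n : nat) : seq bool :=
  rev [seq odd (n %/ 2 ^ j) | j <- iota 0 (trunc_log 2 n).+1].

(* Main.v *)
(** Enumerate the strings of complexity at most [l] in stages.  The [i] leading
    bits of [N^l] give a stage at which fewer than [2 ^ (l + 1 - i)] of these
    strings are missing, and [N^i] gives the stage at which the enumeration for
    [i] is complete.  Up to [O(log l)] bits the two stages serve equally well.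
    From the first one on, only polynomially many strings of complexity at most
    [i] appear, for each sufficiently long run of late arrivals yields a new
    string of complexity at most [l].  At the second one, the enumeration for
    [l] has reached a count with almost the right [i] leading bits, for
    otherwise the first [i - O(log l)] bits of [N^l] would describe a later
    stage, hence a string of complexity at most [i] not enumerated by the end.
    In both cases the remaining error is a number of [O(log l)] bits. *)

Require Import Defs.
From Stdlib Require Import Cantor Rpow_def RIneq Lra.
From mathcomp Require Import all_boot zify.
From mathcomp Require Import finmap boolp classical_sets cardinality.

Set Implicit Arguments.
Unset Strict Implicit.
Unset Printing Implicit Defensive.

(** * Computable functions *)

Definition pr (a b : nat) : nat := Cantor.to_nat (a, b).
Definition p1 (n : nat) : nat := (Cantor.of_nat n).1.
Definition p2 (n : nat) : nat := (Cantor.of_nat n).2.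
Arguments pr : simpl never.
Arguments p1 : simpl never.
Arguments p2 : simpl never.

Lemma p1_pr a b : p1 (pr a b) = a.
Proof. by rewrite /p1 /pr Cantor.cancel_of_to. Qed.

Lemma p2_pr a b : p2 (pr a b) = b.
Proof. by rewrite /p2 /pr Cantor.cancel_of_to. Qed.

Definition prE := (p1_pr, p2_pr).

Lemma pr_p n : pr (p1 n) (p2 n) = n.
Proof. by rewrite /pr /p1 /p2 -surjective_pairing Cantor.cancel_to_of. Qed.

Lemma pr_lb a b : b <= pr a b.
Proof. by have := Cantor.to_nat_spec a b; rewrite /pr; nia. Qed.

(** Cantor pairing grows quadratically, so nesting pairs to a fixed depth keeps the bit length of a
    tuple linear in that of its entries. *)
Lemma pr_exp_bound e a b : a <= 2 ^ e -> b <= 2 ^ e -> pr a b <= 2 ^ (2 * e + 3).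
Proof.
have -> : 2 ^ (2 * e + 3) = 8 * (2 ^ e * 2 ^ e).
  by rewrite expnD mul2n -addnn expnD mulnC.
have := Cantor.to_nat_spec a b; rewrite /pr.
have : 0 < 2 ^ e by rewrite expn_gt0.
by move: (2 ^ e) => x; nia.
Qed.

Definition computable (f : nat -> nat) : Prop :=
  exists c, forall n, eval c n (f n).

Lemma computable_ext f g : f =1 g -> computable f -> computable g.
Proof. by move=> fg [c Hc]; exists c => n; rewrite -fg. Qed.

Lemma computable_comp f g :
  computable f -> computable g -> computable (fun n => f (g n)).
Proof. by move=> [c Hc] [d Hd]; exists (CComp c d) => n; apply: EvalComp. Qed.

Lemma computable_pr f g :
  computable f -> computable g -> computable (fun n => pr (f n) (g n)).
Proof. by move=> [c Hc] [d Hd]; exists (CPair c d) => n; apply: EvalPair. Qed.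

Lemma computable_p1 f : computable f -> computable (fun n => p1 (f n)).
Proof. by apply: computable_comp; exists CLeft => n; apply: EvalLeft. Qed.

Lemma computable_p2 f : computable f -> computable (fun n => p2 (f n)).
Proof. by apply: computable_comp; exists CRight => n; apply: EvalRight. Qed.

Lemma computable_id : computable (fun n => n).
Proof.
exists (CPair CLeft CRight) => n; rewrite -{2}(pr_p n).
by apply: EvalPair; [apply: EvalLeft | apply: EvalRight].
Qed.

Lemma computable_S f : computable f -> computable (fun n => (f n).+1).
Proof. by apply: (@computable_comp S); exists CSucc => n; apply: EvalSucc. Qed.

Lemma computable_const k : computable (fun _ => k).
Proof.
elim: k => [|k]; last exact: computable_S.
by exists CZero => n; apply: EvalZero.
Qed.

Lemma computable_nat_rect f g h :
  computable f -> computable (fun z => g (p1 z) (p1 (p2 z)) (p2 (p2 z))) ->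
  computable h ->
  computable (fun n => nat_rect (fun=> nat) (f n) (fun k r => g n k r) (h n)).
Proof.
move=> [c Hc] [d Hd] Ch.
have [e He] := computable_pr computable_id Ch.
exists (CComp (CPrec c d) e) => n; apply: EvalComp (He n) _.
elim: (h n) => [|k IH] /=; first exact: EvalPrec0.
apply: EvalPrecS IH _.
by have := Hd (pr n (pr k (nat_rect (fun=> nat) (f n) (fun k r => g n k r) k)));
   rewrite !prE.
Qed.

Definition computable2 (f : nat -> nat -> nat) : Prop :=
  computable (fun n => f (p1 n) (p2 n)).

Lemma computable2_app f a b : computable2 f ->
  computable a -> computable b -> computable (fun n => f (a n) (b n)).
Proof.
move=> Cf Ca Cb.
apply: computable_ext (computable_comp Cf (computable_pr Ca Cb)) => n.
by rewrite !prE.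
Qed.

Lemma computable_add f g :
  computable f -> computable g -> computable (fun n => f n + g n).
Proof.
move=> Cf Cg; apply: (@computable_ext (fun n =>
  nat_rect (fun=> nat) (f n) (fun _ r => r.+1) (g n))) => [n|].
  by elim: (g n) => [|k /= ->]; rewrite ?addn0 ?addnS.
apply: computable_nat_rect Cf _ Cg.
exact: computable_S (computable_p2 (computable_p2 computable_id)).
Qed.

Lemma computable_mul f g :
  computable f -> computable g -> computable (fun n => f n * g n).
Proof.
move=> Cf Cg; apply: (@computable_ext (fun n =>
  nat_rect (fun=> nat) 0 (fun _ r => f n + r) (g n))) => [n|].
  by elim: (g n) => [|k /= ->]; rewrite ?muln0 ?mulnS.
apply: (@computable_nat_rect _ (fun n _ r => f n + r)) (computable_const 0) _ Cg.
apply: computable_add; last exact: computable_p2 (computable_p2 computable_id).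
exact: computable_comp Cf (computable_p1 computable_id).
Qed.

Lemma computable_exp f g :
  computable f -> computable g -> computable (fun n => f n ^ g n).
Proof.
move=> Cf Cg; apply: (@computable_ext (fun n =>
  nat_rect (fun=> nat) 1 (fun _ r => f n * r) (g n))) => [n|].
  by elim: (g n) => [|k /= ->]; rewrite ?expn0 ?expnS.
apply: (@computable_nat_rect _ (fun n _ r => f n * r)) (computable_const 1) _ Cg.
apply: computable_mul; last exact: computable_p2 (computable_p2 computable_id).
exact: computable_comp Cf (computable_p1 computable_id).
Qed.

Lemma computable_pred f : computable f -> computable (fun n => (f n).-1).
Proof.
move=> Cf; apply: (@computable_ext (fun n =>
  nat_rect (fun=> nat) 0 (fun k _ => k) (f n))) => [n|]; first by case: (f n).
apply: computable_nat_rect (computable_const 0) _ Cf.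
exact: computable_p1 (computable_p2 computable_id).
Qed.

Lemma computable_sub f g :
  computable f -> computable g -> computable (fun n => f n - g n).
Proof.
move=> Cf Cg; apply: (@computable_ext (fun n =>
  nat_rect (fun=> nat) (f n) (fun _ r => r.-1) (g n))) => [n|].
  by elim: (g n) => [|k /= ->]; rewrite ?subn0 ?subnS.
apply: computable_nat_rect Cf _ Cg.
exact: computable_pred (computable_p2 (computable_p2 computable_id)).
Qed.

Lemma computable_negb (b : nat -> bool) :
  computable (fun n => nat_of_bool (b n)) ->
  computable (fun n => nat_of_bool (~~ b n)).
Proof.
move=> /(computable_sub (computable_const 1)).
by apply: computable_ext => n; case: (b n).
Qed.

Lemma computable_andb (a b : nat -> bool) :
  computable (fun n => nat_of_bool (a n)) ->
  computable (fun n => nat_of_bool (b n)) ->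
  computable (fun n => nat_of_bool (a n && b n)).
Proof.
move=> Ca /(computable_mul Ca).
by apply: computable_ext => n; rewrite mulnb.
Qed.

Lemma computable_eq0 f :
  computable f -> computable (fun n => nat_of_bool (f n == 0)).
Proof.
move=> /(computable_sub (computable_const 1)).
by apply: computable_ext => n; case: (f n).
Qed.

Lemma computable_leq f g : computable f -> computable g ->
  computable (fun n => nat_of_bool (f n <= g n)).
Proof. by move=> Cf Cg; apply/computable_eq0/computable_sub. Qed.

Lemma computable_eqn f g : computable f -> computable g ->
  computable (fun n => nat_of_bool (f n == g n)).
Proof.
move=> Cf Cg; apply: (@computable_ext (fun n => (f n <= g n) && (g n <= f n))).
  by move=> n; rewrite -eqn_leq.
by apply: computable_andb; apply: computable_leq.
Qed.

Lemma computable_if (b : nat -> bool) f g :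
  computable (fun n => nat_of_bool (b n)) -> computable f -> computable g ->
  computable (fun n => if b n then f n else g n).
Proof.
move=> Cb Cf Cg; apply: (@computable_ext (fun n => b n * f n + ~~ b n * g n)).
  by move=> n; case: (b n); rewrite /= ?mul1n ?mul0n ?addn0.
by apply: computable_add; apply: computable_mul => //; apply: computable_negb.
Qed.

Lemma computable_odd f :
  computable f -> computable (fun n => nat_of_bool (odd (f n))).
Proof.
move=> Cf; apply: (@computable_ext (fun n =>
  nat_rect (fun=> nat) 0 (fun _ r => 1 - r) (f n))) => [n|].
  by elim: (f n) => [|k /= ->] //; case: (odd k).
apply: computable_nat_rect (computable_const 0) _ Cf.
apply: computable_sub (computable_const 1) _.
exact: computable_p2 (computable_p2 computable_id).
Qed.

Lemma computable_sum F b : computable2 F -> computable b ->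
  computable (fun n => \sum_(0 <= j < b n) F n j).
Proof.
move=> CF Cb; apply: (@computable_ext (fun n =>
  nat_rect (fun=> nat) 0 (fun k r => r + F n k) (b n))) => [n|].
  elim: (b n) => [|k /= ->]; first by rewrite big_geq.
  by rewrite big_nat_recr.
apply: (@computable_nat_rect _ (fun n k r => r + F n k)) (computable_const 0) _ Cb.
apply: computable_add; first exact: computable_p2 (computable_p2 computable_id).
apply: computable2_app CF _ _; first exact: computable_p1 computable_id.
exact: computable_p1 (computable_p2 computable_id).
Qed.

Lemma sum_ltn_minn m q : \sum_(0 <= j < m) (j < q) = minn m q.
Proof.
elim: m => [|m IH]; first by rewrite big_geq // min0n.
by rewrite big_nat_recr //= IH; lia.
Qed.

Lemma computable_div_exp2 f g : computable f -> computable g ->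
  computable (fun n => f n %/ 2 ^ g n).
Proof.
(* The quotient counts the positive multiples of [2 ^ g n] up to [f n]. *)
move=> Cf Cg; apply: (@computable_ext (fun n =>
  \sum_(0 <= j < f n) (j.+1 * 2 ^ g n <= f n))) => [n|].
  have d0 : 0 < 2 ^ g n by rewrite expn_gt0.
  under eq_bigr => j _ do rewrite -leq_divRL //.
  rewrite sum_ltn_minn; apply/minn_idPr; exact: leq_div.
apply: (@computable_sum (fun n j => j.+1 * 2 ^ g n <= f n) f _ Cf).
apply: computable_leq; last exact: computable_comp Cf (computable_p1 computable_id).
apply: computable_mul; first exact: computable_S (computable_p2 computable_id).
apply: computable_exp; first exact: computable_const.
exact: computable_comp Cg (computable_p1 computable_id).
Qed.

Ltac computability_step :=
  lazymatch goal with
  | |- computable2 _ => rewrite /computable2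
  | |- computable (fun n => n) => apply: computable_id
  | |- computable (fun n => S (@?f n)) => apply: (@computable_S f)
  | |- computable (fun n => pr (@?f n) (@?g n)) => apply: (@computable_pr f g)
  | |- computable (fun n => p1 (@?f n)) => apply: (@computable_p1 f)
  | |- computable (fun n => p2 (@?f n)) => apply: (@computable_p2 f)
  | |- computable (fun n => predn (@?f n)) => apply: (@computable_pred f)
  | |- computable (fun n => addn (@?f n) (@?g n)) => apply: (@computable_add f g)
  | |- computable (fun n => muln (@?f n) (@?g n)) => apply: (@computable_mul f g)
  | |- computable (fun n => subn (@?f n) (@?g n)) => apply: (@computable_sub f g)
  | |- computable (fun n => divn (@?f n) (expn 2 (@?g n))) =>
      apply: (@computable_div_exp2 f g)
  | |- computable (fun n => expn (@?f n) (@?g n)) => apply: (@computable_exp f g)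
  | |- computable (fun n => nat_of_bool (odd (@?f n))) =>
      apply: (@computable_odd f)
  | |- computable (fun n => nat_of_bool (~~ @?f n)) =>
      apply: (@computable_negb f)
  | |- computable (fun n => nat_of_bool (@?f n && @?g n)) =>
      apply: (@computable_andb f g)
  | |- computable (fun n => nat_of_bool (@?f n <= @?g n)) =>
      apply: (@computable_leq f g)
  | |- computable (fun n => nat_of_bool (@?f n == @?g n)) =>
      apply: (@computable_eqn f g)
  | |- computable (fun n => match @?b n with true => @?f n | false => @?g n end) =>
      apply: (@computable_if b f g)
  | |- computable (fun n => \sum_(0 <= j < @?b n) @?F n j) =>
      apply: (@computable_sum F b)
  | |- computable (fun n => nat_of_bool (?f (@?a n) (@?b n))) =>
      apply: (@computable2_app (fun x y => nat_of_bool (f x y)) a b); first by []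
  | |- computable (fun n => ?f (@?a n) (@?b n)) =>
      apply: (@computable2_app f a b); first by []
  | |- _ => apply: computable_const
  end; cbv beta.
Ltac computability := repeat computability_step.

(** * Step-bounded evaluation *)

(* [stage c n t] is [0] if [c] has not converged at [n] within the bound [t],
   and [m.+1] if it has converged to [m]; [t] only bounds the searches. *)
Fixpoint stage (c : code) (n t : nat) : nat :=
  match c with
  | CZero => 1
  | CSucc => n.+2
  | CLeft => (p1 n).+1
  | CRight => (p2 n).+1
  | CPair f g =>
      if stage f n t == 0 then 0 else
      if stage g n t == 0 then 0 else
      (pr (stage f n t).-1 (stage g n t).-1).+1
  | CComp f g =>
      if stage g n t == 0 then 0 else stage f (stage g n t).-1 t
  | CPrec f g =>
      nat_rect (fun=> nat) (stage f (p1 n) t)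
        (fun k r => if r == 0 then 0 else stage g (pr (p1 n) (pr k r.-1)) t)
        (p2 n)
  | CMu f =>
      \sum_(0 <= m < t)
        if (stage f (pr n m) t == 1) &&
           (\sum_(0 <= k < m) (stage f (pr n k) t <= 1) == 0)
        then m.+1 else 0
  end.

Lemma computable_stage c : computable2 (stage c).
Proof.
elim: c => [||||f IHf g IHg|f IHf g IHg|f IHf g IHg|f IHf];
  rewrite /computable2 /=; computability.
apply: (@computable_nat_rect (fun z => stage f (p1 (p1 z)) (p2 z))
  (fun z k r => if r == 0 then 0 else stage g (pr (p1 (p1 z)) (pr k r.-1)) (p2 z)) (fun z => p2 (p1 z)));
  computability.
Qed.

(** At most one index passes the test: the value [1] means convergence to zero, and all earlier
    values must exceed [1]. Hence the sum in [stage] performs a bounded search. *)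
Lemma stage_CMu f n t m : stage (CMu f) n t = m.+1 <->
  [/\ m < t, stage f (pr n m) t = 1 & forall k, k < m -> 1 < stage f (pr n k) t].
Proof.
have sumP m' : reflect (forall k, k < m' -> 1 < stage f (pr n k) t)
    (\sum_(0 <= k < m') (stage f (pr n k) t <= 1) == 0).
  rewrite sum_nat_seq_eq0; apply: (iffP allP) => H k.
    by move=> km; have := H k; rewrite mem_index_iota km /= eqb0 -ltnNge; apply.
  by rewrite mem_index_iota => /andP[_ /H]; rewrite /= eqb0 -ltnNge.
have back m' : [/\ m' < t, stage f (pr n m') t = 1 &
    forall k, k < m' -> 1 < stage f (pr n k) t] -> stage (CMu f) n t = m'.+1.
  case=> mt sm Hk /=.
  rewrite (bigD1_seq m') ?mem_index_iota ?iota_uniq //= sm eqxx /=.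
  have /sumP -> := Hk.
  rewrite big1_seq ?addn0 // => j /andP[jm _].
  case: ifP => // /andP[/eqP sj /sumP Hj].
  case: (ltngtP j m') jm => // H _; first by have := Hk _ H; rewrite sj.
  by have := Hj _ H; rewrite sm.
split=> [/= H|]; last exact: back.
have : \sum_(0 <= m < t)
        (if (stage f (pr n m) t == 1) &&
           (\sum_(0 <= k < m) (stage f (pr n k) t <= 1) == 0)
        then m.+1 else 0) != 0 by rewrite H.
rewrite sum_nat_seq_neq0 => /hasP[m']; rewrite mem_index_iota /= => mt.
case: ifP => // /andP[/eqP sm /sumP Hm] _.
have Hm' : [/\ m' < t, stage f (pr n m') t = 1 &
    forall k, k < m' -> 1 < stage f (pr n k) t] by [].
by have := back _ Hm'; rewrite /= H => -[->].
Qed.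

Lemma stage_sound c n t m : stage c n t = m.+1 -> eval c n m.
Proof.
elim: c n t m => [||||f IHf g IHg|f IHf g IHg|f IHf g IHg|f IHf] n t m.
- by case=> <-; apply: EvalZero.
- by case=> <-; apply: EvalSucc.
- by case=> <-; apply: EvalLeft.
- by case=> <-; apply: EvalRight.
- move=> /=; case Ef: (stage f n t) => [|a] //; case Eg: (stage g n t) => [|b] //= [<-].
  by apply: EvalPair; [apply: IHf Ef | apply: IHg Eg].
- move=> /=; case Eg: (stage g n t) => [|b] //= Ef.
  by apply: EvalComp; [apply: IHg Eg | apply: IHf Ef].
- move=> /=; rewrite -[X in eval _ X _](pr_p n); elim: (p2 n) m => [|k IH] m /=.
    by move=> /IHf; apply: EvalPrec0.
  set r := nat_rect _ _ _ _; case Er: r => [|r'] //= Eg.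
  by apply: EvalPrecS; [apply: IH Er | apply: IHg Eg].
- move=> /stage_CMu[_ Hm Hk].
  apply: (@EvalMu f n m (fun k => (stage f (pr n k) t).-2)); last exact: IHf Hm.
  by move=> k /Hk; case E: stage => [|[|v]] // _; apply: IHf E.
Qed.

Lemma stage_mono c n t t' m : t <= t' -> stage c n t = m.+1 -> stage c n t' = m.+1.
Proof.
move=> tt'; elim: c n m => [||||f IHf g IHg|f IHf g IHg|f IHf g IHg|f IHf] n m //.
- move=> /=; case Ef: (stage f n t) => [|a] //; case Eg: (stage g n t) => [|b] //= <-.
  by rewrite (IHf _ _ Ef) (IHg _ _ Eg).
- move=> /=; case Eg: (stage g n t) => [|b] //= Ef.
  by rewrite (IHg _ _ Eg) /= (IHf _ _ Ef).
- move=> /=; elim: (p2 n) m => [|k IH] m /=; first exact: IHf.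
  set r := nat_rect _ _ _ _; case Er: r => [|r'] //= Eg.
  by rewrite (IH _ Er) /= (IHg _ _ Eg).
- move=> /stage_CMu[mt Hm Hk]; apply/stage_CMu.
  split; [exact: leq_trans tt' | exact: IHf | move=> k /Hk].
  by case E: stage => [|v] //; rewrite (IHf _ _ E).
Qed.

Lemma eventually_all (P : nat -> nat -> Prop) m :
  (forall k t t', t <= t' -> P k t -> P k t') ->
  (forall k, k < m -> exists t, P k t) -> exists t, forall k, k < m -> P k t.
Proof.
move=> mono; elim: m => [|m IH] H; first by exists 0.
have [k km|t Ht] := IH; first exact/H/ltnW.
have [t' Ht'] := H m (ltnSn m).
exists (maxn t t') => k; rewrite ltnS leq_eqVlt => /orP[/eqP->|/Ht].
  exact: mono (leq_maxr _ _) Ht'.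
exact: mono (leq_maxl _ _).
Qed.

Lemma stage_complete c n m : eval c n m -> exists t, stage c n t = m.+1.
Proof.
elim=> {c n m}; try by exists 0.
- move=> f g n a b _ [t Ht] _ [t' Ht']; exists (maxn t t') => /=.
  by rewrite (stage_mono (leq_maxl _ _) Ht) (stage_mono (leq_maxr _ _) Ht').
- move=> f g n a b _ [t Ht] _ [t' Ht']; exists (maxn t t') => /=.
  by rewrite (stage_mono (leq_maxl _ _) Ht) /= (stage_mono (leq_maxr _ _) Ht').
- by move=> f g a m _ [t Ht]; exists t; rewrite -/(pr a 0) /= !prE.
- move=> f g a k r m _ [t Ht] _ [t' Ht']; exists (maxn t t').
  move: Ht Ht'; rewrite -!/(pr _ _) => Ht Ht'.
  have := stage_mono (leq_maxl t t') Ht; rewrite /= !prE /= => -> /=.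
  by rewrite (stage_mono (leq_maxr _ _) Ht').
- move=> f n m v _ Hk _ [t' Ht'].
  have [||t Ht] := @eventually_all (fun k t => stage f (pr n k) t = (v k).+2) m.
  + by move=> k t1 t2; apply: stage_mono.
  + by move=> k /Hk.
  (* [stage] searches only below its bound, whence [m.+1]. *)
  exists (maxn (maxn t t') m.+1); apply/stage_CMu; split.
  + by rewrite leq_maxr.
  + by apply: stage_mono Ht'; rewrite !leq_max leqnn orbT.
  + move=> k /Ht H; rewrite (stage_mono _ H) //.
    by rewrite !leq_max leqnn.
Qed.

Lemma eval_fun c n m m' : eval c n m -> eval c n m' -> m = m'.
Proof.
move=> /stage_complete[t Ht] /stage_complete[t' Ht'].
have := stage_mono (leq_maxl t t') Ht.
by rewrite (stage_mono (leq_maxr t t') Ht') => -[].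
Qed.

Lemma eval_CComp_r f g n m : eval (CComp f g) n m -> exists a, eval g n a.
Proof. by move=> H; inversion H; subst; exists a. Qed.

Lemma eval_CPair_r f g n m : eval (CPair f g) n m -> exists b, eval g n b.
Proof. by move=> H; inversion H; subst; exists b. Qed.

Lemma eval_CMu f n m : eval (CMu f) n m -> eval f (pr n m) 0.
Proof. by move=> H; inversion H. Qed.

(** Minimization looks for zeros, so it is applied to the negation of [T]. The first clause, that
    halting entails a witness, later yields prefix-freeness. *)
Lemma search_code (T : nat -> nat -> bool) (g : nat -> nat -> nat) :
  computable2 T -> computable2 g ->
  exists M, (forall n x, eval M n x -> exists z, T n z) /\
    (forall n z0, T n z0 -> exists2 z, T n z & eval M n (g n z)).
Proof.
move=> /computable_negb[cT HT] [cg Hg].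
have [cid Hid] := computable_id.
have HT' n z : eval cT (pr n z) (~~ T n z) by have := HT (pr n z); rewrite !prE.
exists (CComp cg (CPair cid (CMu cT))); split=> [n x H|n z0 Tz0].
  have [a /eval_CPair_r[z Hz]] := eval_CComp_r H.
  by exists z; have := eval_fun (HT' n z) (eval_CMu Hz); case: (T n z).
have ex : exists z, T n z by exists z0.
case: (ex_minnP ex) => z Tz minz; exists z => //.
apply: (@EvalComp _ _ _ (pr n z)); last by have := Hg (pr n z); rewrite !prE.
apply: EvalPair => //; apply: (@EvalMu cT n z (fun=> 0)) => [k kz|].
  have := HT' n k; case E: (T n k) => //.
  by have := minz _ E; rewrite leqNgt kz.
by have := HT' n z; rewrite Tz.
Qed.

Local Notation num := num_of_string.

(** * Strings and self-delimiting programs *)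

Lemma num_cons b s : num (b :: s) = (num s).*2 + b.+1.
Proof. by []. Qed.

Lemma num_cat s1 s2 : num (s1 ++ s2) = num s1 + 2 ^ size s1 * num s2.
Proof.
elim: s1 => [|b s IH]; first by rewrite /= mul1n.
by rewrite cat_cons !num_cons IH /= expnS; lia.
Qed.

Lemma num_inj : injective num.
Proof.
elim=> [|b s IH] [|b' s'] //; rewrite ?num_cons ?addnS // => E.
have Eb : b = b' by move: E; case: b; case: b'; lia.
by rewrite Eb in E *; rewrite (IH s') //; lia.
Qed.

Lemma num_size_bounds s : 2 ^ size s <= (num s).+1 < 2 ^ (size s).+1.
Proof.
elim: s => [|b s] //; rewrite num_cons /= !expnS; case: b; lia.
Qed.

Fixpoint fixed_width (S u : nat) : seq bool :=
  if S is S'.+1 then odd u :: fixed_width S' u./2 else [::].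

Lemma size_fixed_width S u : size (fixed_width S u) = S.
Proof. by elim: S u => //= S IH u; rewrite IH. Qed.

(** Each digit is a bit plus one; the surplus adds up to [2 ^ S - 1]. *)
Lemma num_fixed_width S u : u < 2 ^ S -> num (fixed_width S u) = 2 ^ S - 1 + u.
Proof.
elim: S u => [|S IH] u; first by case: u.
have := odd_double_half u; have : 0 < 2 ^ S by rewrite expn_gt0.
rewrite expnS => S0 Eu uS; rewrite [fixed_width _ _]/= num_cons IH; last by lia.
by lia.
Qed.

(** The binary digits of [n.+1] without the leading one, lowest first. *)
Definition string_of_num (n : nat) : seq bool :=
  fixed_width (trunc_log 2 n.+1) (n.+1 - 2 ^ trunc_log 2 n.+1).

Lemma string_of_numK : cancel string_of_num num.
Proof.
move=> n; have /andP[lb ub] := trunc_log_bounds (leqnn 2) (ltn0Sn n).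
have S0 : 0 < 2 ^ trunc_log 2 n.+1 by rewrite expn_gt0.
by rewrite num_fixed_width; rewrite expnS in ub; lia.
Qed.

Lemma numK : cancel num string_of_num.
Proof. by move=> s; apply: num_inj; rewrite string_of_numK. Qed.

(* A self-delimiting code: the unary block announces the width of the header
   [b], whose first component announces the width of the payload [u]. *)
Definition encode (k b u : nat) : seq bool :=
  nseq k true ++ false :: fixed_width k b ++ fixed_width (p1 b) u.

(** A closed arithmetic form lets a machine recognize a codeword without any operation on
    strings. *)
Definition encode_num (k b u : nat) : nat :=
  2 * (2 ^ k - 1) + 2 ^ k *
    (1 + 2 * (2 ^ k - 1 + b + 2 ^ k * (2 ^ p1 b - 1 + u))).

Lemma num_encode k b u : b < 2 ^ k -> u < 2 ^ p1 b ->
  num (encode k b u) = encode_num k b u.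
Proof.
move=> bk uS; rewrite num_cat num_cons num_cat !num_fixed_width //.
rewrite size_nseq size_fixed_width.
have -> : num (nseq k true) = 2 * (2 ^ k - 1).
  elim: k {bk} => // k IH; rewrite [nseq _ _]/= num_cons IH expnS.
  have : 0 < 2 ^ k by rewrite expn_gt0.
  by lia.
by rewrite /encode_num; lia.
Qed.

(** A codeword can be parsed from the left: the first [false] gives [k], the next [k] bits give [b],
    and [p1 b] tells where [u] ends. *)
Lemma encode_prefix_inj k b u k' b' u' :
  b < 2 ^ k -> u < 2 ^ p1 b -> b' < 2 ^ k' -> u' < 2 ^ p1 b' ->
  prefix (encode k b u) (encode k' b' u') -> [/\ k = k', b = b' & u = u'].
Proof.
move=> bk uS bk' uS' /prefixP[s]; rewrite /encode -catA cat_cons => E.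
have Ek : k' = k.
  have aux A A' : nseq k' true ++ false :: A = nseq k true ++ false :: A' -> k' = k.
    by elim: k k' {bk bk' E} => [|k IH] [|k'] //= [/IH ->].
  exact: aux E.
subst k'; move/eqP: E.
rewrite eqseq_cat // eqxx -!catA /= eqseq_cons /= eqseq_cat ?size_fixed_width //.
case/andP=> /eqP/(congr1 num); rewrite !num_fixed_width // => /addnI Eb /eqP E.
subst b'; split=> //.
have /(congr1 num) : fixed_width (p1 b) u' = fixed_width (p1 b) u.
  move: E; rewrite -[LHS]cats0 => /eqP.
  by rewrite eqseq_cat ?size_fixed_width // => /andP[/eqP].
by rewrite !num_fixed_width // => /addnI.
Qed.

Lemma encode_num_inj k b u k' b' u' :
  b < 2 ^ k -> u < 2 ^ p1 b -> b' < 2 ^ k' -> u' < 2 ^ p1 b' ->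
  encode_num k b u = encode_num k' b' u' -> [/\ k = k', b = b' & u = u'].
Proof.
move=> bk uS bk' uS'; rewrite -!num_encode // => /num_inj E.
by apply: encode_prefix_inj => //; rewrite E prefix_refl.
Qed.

Lemma KC_le_size U p y x : run U p y x -> KC U x y <= size p.
Proof.
move=> H; rewrite /KC; case: pselect => // h; case: ex_minnP => m _; apply.
by apply/asboolP; exists p.
Qed.

Lemma KC_program U x y : (exists p, run U p y x) ->
  exists2 p, size p = KC U x y & run U p y x.
Proof.
move=> [p H]; rewrite /KC; case: pselect => [h|[]]; last first.
  by exists (size p); apply/asboolP; exists p.
by case: ex_minnP => m /asboolP.
Qed.

(* The machine searches for the least [v] witnessing [test] and then outputs
   [g]; its program consists of the parameters [b] in self-delimiting form and
   of the payload [u] of length [p1 b]. *)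
Lemma universal_search U : universal_prefix_machine U ->
  forall (test : nat -> nat -> bool) (g : nat -> nat -> nat),
  computable2 test -> computable2 g ->
  exists c, forall k b u y v x, b < 2 ^ k -> u < 2 ^ p1 b ->
    test (pr b (pr u (num y))) v ->
    (forall v', v' < v -> ~~ test (pr b (pr u (num y))) v') ->
    num x = g (pr b (pr u (num y))) v ->
    exists2 p, size p <= c + 2 * k + p1 b & run U p y x.
Proof.
move=> [_ univ] test g Ct Cg.
(* [z] codes [(k, (b, (u, v)))] and [n] codes the program with the condition: the program is parsed
   by guessing its parts along with the witness. *)
pose arg n z := pr (p1 (p2 z)) (pr (p1 (p2 (p2 z))) (p2 n)).
pose wit z := p2 (p2 (p2 z)).
pose wf z := (p1 (p2 z) < 2 ^ p1 z) && (p1 (p2 (p2 z)) < 2 ^ p1 (p1 (p2 z))).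
pose code z := encode_num (p1 z) (p1 (p2 z)) (p1 (p2 (p2 z))).
(* Leastness of [v] leaves at most one admissible [z] for each [n]. *)
pose T n z := [&& code z == p1 n, wf z, test (arg n z) (wit z) &
  \sum_(0 <= v' < wit z) test (arg n z) v' == 0].
have [||M [MT Mg]] := @search_code T (fun n z => g (arg n z) (wit z)).
- by rewrite /T /wf /code /arg /wit /encode_num; computability.
- by rewrite /arg /wit; computability.
(* A halting program is a codeword, and no codeword properly extends another. *)
have prefM : prefix_machine M.
  move=> y p q [x Hp] [x' Hq].
  have [z] := MT _ _ Hp; have [z'] := MT _ _ Hq; rewrite -!/(pr _ _).
  rewrite /T !prE.
  case/and4P=> /eqP; rewrite /code => Ez' /andP[bz' uz'] _ _.
  case/and4P=> /eqP; rewrite /code => Ez /andP[bz uz] _ _.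
  rewrite -num_encode // in Ez; rewrite -num_encode // in Ez'.
  have <- := num_inj Ez; have <- := num_inj Ez'.
  by move=> /encode_prefix_inj[] // -> -> ->.
have [e He] := univ M prefM.
(* The prefix [e] and the separating [false] make up the constant. *)
exists (size e).+1 => k b u y v x bk uS tv minv Ex.
have sumP w n : reflect (forall v', v' < w -> ~~ test n v')
    (\sum_(0 <= v' < w) test n v' == 0).
  rewrite sum_nat_seq_eq0; apply: (iffP allP) => H v'.
    by move=> vw; have := H v'; rewrite mem_index_iota vw /= eqb0; apply.
  by rewrite mem_index_iota => /andP[_ /H]; rewrite /= eqb0.
have [|z] := Mg (pr (encode_num k b u) (num y)) (pr k (pr b (pr u v))).
  by rewrite /T /wf /code /arg /wit !prE eqxx bk uS tv; apply/sumP.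
rewrite /T /arg /code /wf !prE.
case/and4P=> /eqP E /andP[bz uz] tz /sumP minz Hz.
have [Ek Eb Eu] := encode_num_inj bz uz bk uS E.
rewrite Eb Eu in tz minz Hz.
have Ev : wit z = v.
  case: (ltngtP (wit z) v) => // [/minv | /minz]; first by rewrite tz.
  by rewrite tv.
exists (e ++ encode k b u).
  rewrite size_cat /encode size_cat size_nseq /= size_cat !size_fixed_width.
  by lia.
by apply/He; rewrite /run Ex num_encode // -Ev.
Qed.

(** Ensures that [KC] never takes its dummy value: the header carries [num x], the payload is empty,
    and the search succeeds at once. *)
Lemma universal_program U : universal_prefix_machine U ->
  forall x y, exists p, run U p y x.
Proof.
move=> hU x y.
have [||c H] := @universal_search U hU (fun _ _ => true) (fun n _ => p2 (p1 n)).
- by computability.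
- by computability.
have [|||||p _ Hp] := H (pr 0 (num x)) (pr 0 (num x)) 0 y 0 x; rewrite ?prE //.
- exact: ltn_expl.
- by exists p.
Qed.

(** * Binary notation *)

Definition bits (L v : nat) : seq bool :=
  [seq odd (v %/ 2 ^ (L.-1 - j)) | j <- iota 0 L].

Lemma size_bits L v : size (bits L v) = L.
Proof. by rewrite size_map size_iota. Qed.

Lemma binaryE n : binary n = bits (trunc_log 2 n).+1 n.
Proof.
rewrite /binary /bits; apply: (@eq_from_nth _ false).
  by rewrite size_rev !size_map.
move=> j; rewrite size_rev size_map size_iota => jL.
rewrite nth_rev ?size_map ?size_iota // !(nth_map 0) ?size_iota //; last by lia.
by rewrite !nth_iota ?add0n //; lia.
Qed.

Lemma size_binary n : size (binary n) = (trunc_log 2 n).+1.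
Proof. by rewrite binaryE size_bits. Qed.

Lemma ltn_exp_size_binary n : n < 2 ^ size (binary n).
Proof. by rewrite size_binary trunc_log_ltn. Qed.

Lemma take_bits i L v : i <= L -> take i (bits L v) = bits i (v %/ 2 ^ (L - i)).
Proof.
move=> iL; rewrite /bits -map_take take_iota (minn_idPl iL).
apply/eq_in_map => j; rewrite mem_iota => /andP[_ ji].
by rewrite -divnMA -expnD; do 3!congr (_ _); lia.
Qed.

Lemma take_binary i n : i <= size (binary n) ->
  take i (binary n) = bits i (n %/ 2 ^ (size (binary n) - i)).
Proof. by rewrite size_binary binaryE => /take_bits ->. Qed.

Lemma bits_inj L v v' : v < 2 ^ L -> v' < 2 ^ L -> bits L v = bits L v' -> v = v'.
Proof.
elim: L v v' => [|L IH] v v'; first by case: v; case: v'.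
rewrite expnS => vL vL' E.
have /IH Eh : bits L (v %/ 2) = bits L (v' %/ 2).
  by have := congr1 (take L) E; rewrite !take_bits // subSnn.
have Eo : odd v = odd v'.
  have := congr1 (fun s => nth false s L) E.
  by rewrite /bits !(nth_map 0) ?size_iota // nth_iota //= subnn !divn1.
rewrite (divn_eq v 2) (divn_eq v' 2) !modn2 Eo Eh //; lia.
Qed.

Definition bits_num (L v : nat) : nat :=
  \sum_(0 <= j < L) 2 ^ j * (odd (v %/ 2 ^ (L.-1 - j))).+1.

Lemma num_bits L v : num (bits L v) = bits_num L v.
Proof.
(* The number of digits is separated from the [L] in the exponents, which must stay fixed during the
   induction. *)
rewrite /bits /bits_num; move: {2 3}L => m.
elim: m => [|m IH]; first by rewrite big_geq.
have -> : iota 0 m.+1 = iota 0 m ++ [:: m] by rewrite -addn1 iotaD.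
by rewrite map_cat num_cat IH size_map size_iota big_nat_recr.
Qed.

Lemma computable_bits_num : computable2 bits_num.
Proof. by rewrite /bits_num; computability. Qed.

(** * Enumeration of the strings of bounded complexity *)

(** The [0] in the pair is the number of the empty condition. A result [x.+1] stands for the output
    numbered [x], and [0] for none yet. *)
Definition output (U : code) (q t : nat) : nat := stage U (pr q 0) t.

(* Programs of length at most [l] have numbers below [2 ^ l.+1 - 1], so this
   exceeds the number of every string they have produced by stage [t]. *)
Definition output_bound (U : code) (l t : nat) : nat :=
  \sum_(0 <= q < (2 ^ l.+1).-1) output U q t.

Definition enumerated (U : code) (l t : nat) : seq nat :=
  [seq x <- iota 0 (output_bound U l t) |
    has (fun q => output U q t == x.+1) (iota 0 (2 ^ l.+1).-1)].

Definition count_by (U : code) (l t : nat) : nat := size (enumerated U l t).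

Lemma enumerated_uniq U l t : uniq (enumerated U l t).
Proof. by rewrite filter_uniq // iota_uniq. Qed.

Lemma enumeratedP U l t x : reflect
  (exists2 q, q < (2 ^ l.+1).-1 & output U q t = x.+1) (x \in enumerated U l t).
Proof.
rewrite mem_filter mem_iota add0n leq0n /=; apply: (iffP andP).
  by case=> /hasP[q]; rewrite mem_iota => /andP[_ ql] /eqP E _; exists q.
case=> q ql E; split; first by apply/hasP; exists q; rewrite ?mem_iota ?E.
rewrite -E /output_bound (bigD1_seq q) ?mem_index_iota ?iota_uniq //=.
exact: leq_addr.
Qed.

Lemma enumerated_ltn_bound U l t x :
  x \in enumerated U l t -> x < output_bound U l t.
Proof. by rewrite mem_filter mem_iota => /and3P[]. Qed.

Lemma enumerated_mono U l t t' : t <= t' ->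
  {subset enumerated U l t <= enumerated U l t'}.
Proof.
move=> tt' x /enumeratedP[q ql E]; apply/enumeratedP; exists q => //.
exact: stage_mono E.
Qed.

Lemma count_by_mono U l t t' : t <= t' -> count_by U l t <= count_by U l t'.
Proof.
by move=> tt'; rewrite uniq_leq_size ?enumerated_uniq //; apply: enumerated_mono.
Qed.

(** Distinct strings need distinct programs, and there are [2 ^ l.+1 - 1] programs of length at most
    [l]. *)
Lemma count_by_ltn_exp U l t : count_by U l t < 2 ^ l.+1.
Proof.
have p0 : 0 < 2 ^ l.+1 by rewrite expn_gt0.
rewrite -(prednK p0) ltnS -(size_iota 0 (2 ^ l.+1).-1).
rewrite -(size_map (fun q => (output U q t).-1)).
apply: uniq_leq_size (enumerated_uniq _ _ _) _ => x /enumeratedP[q ql E].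
by apply/mapP; exists q; rewrite ?mem_iota ?E.
Qed.

Lemma sum1_nat_has (s : seq nat) (a : pred nat) :
  (if has a s then 1 else 0) = (0 < \sum_(q <- s) a q).
Proof.
have -> : \sum_(q <- s) a q = count a s.
  by rewrite -sum1_count [RHS]big_mkcond; apply: eq_bigr => q _; case: (a q).
by rewrite has_count; case: (0 < _).
Qed.

Lemma computable_output_bound U : computable2 (output_bound U).
Proof.
have C := computable_stage U.
by rewrite /output_bound /output; computability.
Qed.

Lemma computable_count_by U : computable2 (count_by U).
Proof.
have C := computable_stage U; have CB := computable_output_bound U.
apply: (@computable_ext (fun n => \sum_(0 <= x < output_bound U (p1 n) (p2 n))
  (0 < \sum_(0 <= q < (2 ^ (p1 n).+1).-1) (output U q (p2 n) == x.+1)))) => [n|].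
  rewrite /count_by /enumerated size_filter -sum1_count [RHS]big_mkcond /=.
  rewrite /index_iota !subn0; apply: eq_bigr => x _.
  by rewrite sum1_nat_has.
by rewrite /output; computability.
Qed.

Lemma size_filter_notin (s1 s2 : seq nat) :
  size [seq x <- s2 | x \notin s1] + size [seq x <- s2 | x \in s1] = size s2.
Proof. by rewrite !size_filter addnC count_predC. Qed.

Lemma KC0_leP U l y : universal_prefix_machine U ->
  KC0 U y <= l <-> exists t, num y \in enumerated U l t.
Proof.
move=> hU; split=> [Kl|[t /enumeratedP[q ql /stage_sound H]]].
  have [p sp /stage_complete[t Ht]] := KC_program (universal_program hU y [::]).
  exists t; apply/enumeratedP; exists (num p); last exact: Ht.
  have /andP[_ ub] := num_size_bounds p.
  have : 2 ^ (size p).+1 <= 2 ^ l.+1 by rewrite leq_exp2l // ltnS sp.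
  by lia.
have /andP[lb _] := num_size_bounds (string_of_num q).
rewrite string_of_numK in lb.
have Hl : size (string_of_num q) <= l.
  rewrite -ltnS -(ltn_exp2l _ _ (ltnSn 1)); lia.
by apply: leq_trans (KC_le_size _) Hl; rewrite /run string_of_numK.
Qed.

(** Only finitely many programs matter, so from some stage on none of them newly halts. Whether each
    one halts is decided classically; no computability of [tau] is claimed. *)
Lemma enumerated_limit U l : universal_prefix_machine U ->
  exists tau, [/\ forall y, KC0 U y <= l <-> num y \in enumerated U l tau,
    Ncount U l = count_by U l tau &
    forall t, {subset enumerated U l t <= enumerated U l tau}].
Proof.
move=> hU.
have [||tau Htau] := @eventually_all
    (fun q t => forall t', 0 < output U q t' -> 0 < output U q t) (2 ^ l.+1).-1.
- move=> q t t' tt' H t'' /H; case E: (output U q t) => [|x] // _.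
  by rewrite /output (stage_mono tt' E).
- move=> q _; have [[t Ht]|nH] := pselect (exists t, 0 < output U q t).
    by exists t.
  by exists 0 => t' Ht'; case: nH; exists t'.
have sub t : {subset enumerated U l t <= enumerated U l tau}.
  move=> x /enumeratedP[q ql E]; apply/enumeratedP; exists q => //.
  have := Htau q ql t; rewrite E => /(_ isT).
  case E': (output U q tau) => [|x'] // _.
  have := stage_mono (leq_maxl t tau) E.
  by rewrite (stage_mono (leq_maxr t tau) E') => -[->].
have KP y : KC0 U y <= l <-> num y \in enumerated U l tau.
  by rewrite KC0_leP //; split=> [[t /sub]|]; last by exists tau.
exists tau; split=> //.
pose s := [seq string_of_num x | x <- enumerated U l tau].
have -> : Ncount U l = #|` [fset y in s]%fset|.
  rewrite /Ncount; congr (#|` _|); rewrite -[RHS]set_fsetK; congr fset_set.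
  apply/seteqP; split=> y /=; rewrite inE.
    by move=> /KP Hy; apply/mapP; exists (num y); rewrite ?numK.
  by case/mapP=> x Hx ->; apply/KP; rewrite string_of_numK.
rewrite card_fseq undup_id ?size_map // map_inj_uniq ?enumerated_uniq //.
exact: can_inj string_of_numK.
Qed.

Lemma Ncount_ltn_exp U l : universal_prefix_machine U -> Ncount U l < 2 ^ l.+1.
Proof. by move=> /(enumerated_limit l)[tau [_ -> _]]; apply: count_by_ltn_exp. Qed.

Lemma count_by_leq_Ncount U l t :
  universal_prefix_machine U -> count_by U l t <= Ncount U l.
Proof.
move=> /(enumerated_limit l)[tau [_ -> sub]].
exact: uniq_leq_size (enumerated_uniq _ _ _) (sub t).
Qed.

Lemma size_binary_Ncount U l :
  universal_prefix_machine U -> size (binary (Ncount U l)) <= l.+1.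
Proof.
move=> /(Ncount_ltn_exp l); rewrite size_binary ltnS.
case: (posnP (Ncount U l)) => [->|N0] H; first by rewrite trunc_log0.
rewrite -ltnS -(ltn_exp2l _ _ (ltnSn 1)).
by apply: leq_ltn_trans H; apply: trunc_logP.
Qed.

(** * Comparison of the two stages *)

(** [S] comes first because [universal_search] reads the payload width there. The entries [e], [f],
    [g] shape the threshold [u * 2 ^ e %/ 2 ^ f + g], which serves both comparisons. *)
Definition params (S l1 e f g l2 : nat) : nat :=
  pr S (pr l1 (pr e (pr f (pr g l2)))).

(* A string produced after the enumeration of [l1] has reached a prescribed
   count, chosen beyond everything enumerated for [l2] at that stage. *)
Lemma fresh_string U : universal_prefix_machine U ->
  exists c, forall k S l1 e f g l2 u t0,
    params S l1 e f g l2 < 2 ^ k -> u < 2 ^ S ->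
    (u * 2 ^ e) %/ 2 ^ f + g <= count_by U l1 t0 ->
    exists2 t, (u * 2 ^ e) %/ 2 ^ f + g <= count_by U l1 t &
      KC0 U (string_of_num (pr u (output_bound U l2 t))) <= c + 2 * k + S.
Proof.
move=> hU.
have CB := computable_output_bound U; have CC := computable_count_by U.
(* Parameter [i] is [p1 (ix n i)], except that the last one is [ix n 5] itself. *)
pose ix n i := iter i p2 (p1 n).
pose test n t := (p1 (p2 n) * 2 ^ p1 (ix n 2)) %/ 2 ^ p1 (ix n 3) + p1 (ix n 4)
   <= count_by U (p1 (ix n 1)) t.
(* Storing [u] keeps the strings of different payloads distinct. *)
pose g n t := pr (p1 (p2 n)) (output_bound U (ix n 5) t).
have [||c Hc] := @universal_search U hU test g.
- by rewrite /test /ix; cbn [iter]; computability.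
- by rewrite /g /ix; cbn [iter]; computability.
exists c => k S l1 e f d l2 u t0 bk uS H0.
pose n := pr (params S l1 e f d l2) (pr u (num [::])).
have testE t : test n t = ((u * 2 ^ e) %/ 2 ^ f + d <= count_by U l1 t).
  by rewrite /test /n /ix /params /= !prE.
have ex : exists t, test n t by exists t0; rewrite testE.
case: (ex_minnP ex) => t Ht mint; exists t; first by rewrite -testE.
have p1S : p1 (params S l1 e f d l2) = S by rewrite /params prE.
have := Hc k _ u [::] t (string_of_num (pr u (output_bound U l2 t))) bk.
rewrite p1S => /(_ uS Ht) [].
- by move=> t' t't; apply: contraL t't => /mint; rewrite -leqNgt.
- by rewrite string_of_numK /g /ix /params /= !prE.
- by move=> p sp Hp; apply: leq_trans (KC_le_size Hp) sp.
Qed.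

(** A pair is at least its second component, and every enumerated number lies below the bound. *)
Lemma fresh_notin_enumerated U l t t' u : t' <= t ->
  pr u (output_bound U l t) \notin enumerated U l t'.
Proof.
move=> tt'; apply/negP => /(enumerated_mono tt')/enumerated_ltn_bound.
by rewrite ltnNge pr_lb.
Qed.

(** Arithmetic for the next lemma, with [E = 2 ^ i.+1], [M = 2 ^ l.+1] and [n], [c] the two counts
    scaled by [2 ^ S]: the roundings cost at most [2 * E]. *)
Lemma block_count_bound E X M a b c n : X * E = 2 * M -> E <= M ->
  a * E <= c -> n < b.+1 * E -> b <= X + a.+1 -> n <= c + 4 * M.
Proof.
move=> XE EM aE nb bX; have : b * E <= (X + a.+1) * E by rewrite leq_mul2r bX orbT.
by rewrite mulSn in nb; rewrite mulnDl mulSn; lia.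
Qed.

(* Each late arrival in the enumeration for [i] triggers the creation of new
   strings of complexity at most [l], and few of those are still missing. *)
Lemma late_arrivals_bound U : universal_prefix_machine U ->
  exists c, forall k i l t L,
    let D := c + 2 * k in
    params (l - D) i i.+1 (l - D) 1 l < 2 ^ k ->
    i <= l -> L <= l.+1 -> i <= L ->
    (Ncount U l %/ 2 ^ (L - i)) * 2 ^ (L - i) <= count_by U l t ->
    Ncount U i <= count_by U i t + 2 ^ (D + 3).
Proof.
move=> hU; have [c Hc] := fresh_string hU.
exists c => k i l t L D bk il Ll iL Ht.
have Ni := Ncount_ltn_exp i hU.
(* For [l < D] the error term alone exceeds [Ncount U i], and [l - D] would be truncated to [0]. *)
have [lD|Dl] := ltnP l D.
  have : 2 ^ i.+1 <= 2 ^ (D + 3) by rewrite leq_exp2l //; lia.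
  by lia.
set S := l - D in bk.
have ci := count_by_leq_Ncount i t hU.
have [taul [KPl El subl]] := enumerated_limit l hU.
have [taui [_ Ei _]] := enumerated_limit i hU.
set N := Ncount U i in Ni ci Ei *; set ct := count_by U i t in ci *.
have E0 : 0 < 2 ^ i.+1 by rewrite expn_gt0.
have S0 : 0 < 2 ^ S by rewrite expn_gt0.
(* Payload [u] sets the threshold [u * 2 ^ i.+1 %/ 2 ^ S + 1] for the enumeration of [i]. For
   [A <= u < B] it exceeds [ct] and is at most [N], so it is met, but only after stage [t]. *)
pose A := ((ct * 2 ^ S) %/ 2 ^ i.+1).+1.
pose B := (N * 2 ^ S) %/ 2 ^ i.+1.
pose new := [seq x <- enumerated U l taul | x \notin enumerated U l t].
have ulb u : A <= u -> ct * 2 ^ S < u * 2 ^ i.+1.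
  by rewrite /A -ltn_divLR.
have uub u : u < B -> u.+1 * 2 ^ i.+1 <= N * 2 ^ S.
  by rewrite /B leq_divRL.
have sub : {subset iota A (B - A) <= [seq p1 x | x <- new]}.
  move=> u; rewrite mem_iota => /andP[Au uB].
  have {uB} uB : u < B by lia.
  have uS : u < 2 ^ S.
    rewrite -(ltn_pmul2r E0); have := uub _ uB; nia.
  have jN : (u * 2 ^ i.+1) %/ 2 ^ S + 1 <= count_by U i taui.
    by rewrite addn1 -Ei ltn_divLR //; have := uub _ uB; lia.
  have [t' Ht' Kx] := Hc k S i i.+1 S 1 l u taui bk uS jN.
  (* The threshold is not met by stage [t], so the fresh string avoids all that is enumerated for
     [l] at stage [t]. *)
  have tt' : t <= t'.
    rewrite leqNgt; apply/negP => /ltnW/(count_by_mono U i).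
    have : ct <= (u * 2 ^ i.+1) %/ 2 ^ S by rewrite leq_divRL // ltnW // ulb.
    by rewrite -/ct; lia.
  apply/mapP; exists (pr u (output_bound U l t')); last by rewrite prE.
  rewrite mem_filter fresh_notin_enumerated //=.
  have /KPl : KC0 U (string_of_num (pr u (output_bound U l t'))) <= l.
    by apply: leq_trans Kx _; rewrite /S -/D; lia.
  by rewrite string_of_numK.
have := uniq_leq_size (iota_uniq _ _) sub; rewrite size_iota size_map => BA.
have newN : size new + count_by U l t <= Ncount U l.
  rewrite El /count_by -(size_filter_notin (enumerated U l t) (enumerated U l taul)).
  rewrite leq_add2l; apply: uniq_leq_size (enumerated_uniq _ _ _) _ => x xt.
  by rewrite mem_filter xt; apply: subl xt.
have Nl := divn_eq (Ncount U l) (2 ^ (L - i)).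
have := ltn_pmod (Ncount U l) (expn_gt0 2 (L - i)) => /= modN.
(* All of [Ncount U l] but its remainder modulo [2 ^ (L - i)] has been reached, so only that
   remainder can be missing. *)
have {Ht Nl modN newN} newq : size new < 2 ^ (L - i).
  move: (_ %/ _ * _) (_ %% _) Nl modN Ht => w m Nl modN Ht.
  by lia.
have : 2 ^ (L - i) <= 2 ^ (l.+1 - i) by rewrite leq_exp2l //; lia.
have e1 : 2 ^ (l.+1 - i) * 2 ^ i.+1 = 2 ^ l.+2.
  by rewrite -expnD; congr (_ ^ _); lia.
have e2 : 2 ^ (D + 3) * 2 ^ S = 2 ^ l.+3.
  by rewrite -expnD; congr (_ ^ _); rewrite /S; lia.
have e3 : 2 ^ i.+1 <= 2 ^ l.+1 by rewrite leq_exp2l.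
have dA := leq_trunc_div (ct * 2 ^ S) (2 ^ i.+1).
have dB : N * 2 ^ S < B.+1 * 2 ^ i.+1 by rewrite -ltn_divLR.
move=> qle; have BA2 : B - A <= 2 ^ (l.+1 - i).
  exact: leq_trans BA (leq_trans (ltnW newq) qle).
have e4 : 2 ^ l.+3 = 4 * 2 ^ l.+1 by rewrite !(expnS 2 _.+1) mulnA.
rewrite -(leq_pmul2r S0) mulnDl e2 e4.
rewrite (expnS 2 l.+1) in e1.
by apply: (block_count_bound e1 e3 dA dB); rewrite /A in BA2; lia.
Qed.

(* Otherwise the leading bits of [Ncount U l] would describe a stage by which
   the enumeration for [i] is complete, hence a string of complexity at most
   [i] outside of it. *)
Lemma leading_bits_determined U : universal_prefix_machine U ->
  exists c, forall k i l t L,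
    let D := c + 2 * k in
    params (i - D) l (L - (i - D)) 0 0 i < 2 ^ k ->
    i <= L -> Ncount U l < 2 ^ L -> Ncount U i <= count_by U i t ->
    Ncount U l %/ 2 ^ (L - i) <= count_by U l t %/ 2 ^ (L - i) + 2 ^ D.
Proof.
move=> hU; have [c Hc] := fresh_string hU.
exists c => k i l t L D bk iL NL Ht.
have p0 m : 0 < 2 ^ m by rewrite expn_gt0.
(* For [i < D] the quotient, being below [2 ^ i], is within [2 ^ D] anyway. *)
have [iD|Di] := ltnP i D.
  apply: leq_trans (leq_addl _ _); apply: ltnW.
  apply: (@leq_trans (2 ^ i)); last by rewrite leq_exp2l // ltnW.
  by rewrite ltn_divLR // -expnD subnKC.
set S := i - D in bk; set r := L - S in bk.
have [taul [_ El _]] := enumerated_limit l hU.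
have [taui [KPi Ei subi]] := enumerated_limit i hU.
(* Keeping only [S = i - D] leading bits leaves [D] bits for the overhead, so the fresh string has
   complexity at most [i]. *)
set u := Ncount U l %/ 2 ^ r.
have uS : u < 2 ^ S.
  by rewrite ltn_divLR // -expnD /r subnKC // /S; lia.
have uN : u * 2 ^ r <= Ncount U l by apply: leq_trunc_div.
have [|t' Ht' Kx] := Hc k S l r 0 0 i u taul bk uS.
  by rewrite expn0 divn1 addn0 -El.
rewrite expn0 divn1 addn0 in Ht'.
(* Were [t <= t'], the enumeration for [i] would be complete at [t'] and contain the fresh string,
   which exceeds everything enumerated there. *)
have t't : t' < t.
  rewrite ltnNge; apply/negP => tt'.
  have /KPi : KC0 U (string_of_num (pr u (output_bound U i t'))) <= i.
    by apply: leq_trans Kx _; rewrite /S -/D; lia.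
  rewrite string_of_numK.
  have size_le : size (enumerated U i taui) <= size (enumerated U i t').
    rewrite -/(count_by _ _ _) -Ei; apply: leq_trans Ht _.
    exact: count_by_mono.
  have [_ <-] := uniq_min_size (enumerated_uniq _ _ _) (subi t') size_le.
  by rewrite (negPf (fresh_notin_enumerated _ _ _ (leqnn _))).
have cl : u * 2 ^ r <= count_by U l t.
  by apply: leq_trans Ht' _; apply/count_by_mono/ltnW.
(* The [D] further dropped bits are worth [2 ^ D] units of the place [2 ^ (L - i)]. *)
have Er : 2 ^ r = 2 ^ D * 2 ^ (L - i).
  by rewrite -expnD; congr (_ ^ _); rewrite /r /S; lia.
rewrite -divnDMl // leq_div2r // -Er.
have : Ncount U l < u.+1 * 2 ^ r by rewrite -ltn_divLR.
by rewrite mulSn; lia.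
Qed.

(** * The conditional complexities *)

(** The leading [0] is the payload width: the data come from the condition instead. *)
Definition decode_params (l1 L1 k1 l2 L2 k2 d : nat) : nat :=
  pr 0 (pr l1 (pr L1 (pr k1 (pr l2 (pr L2 (pr k2 d)))))).

(* [t] is quantified before the correction [d], which depends on it. *)
Lemma KC_count_by U : universal_prefix_machine U ->
  exists c, forall l1 L1 k1 v t0, v < 2 ^ L1 -> v * 2 ^ k1 <= count_by U l1 t0 ->
    exists2 t, v * 2 ^ k1 <= count_by U l1 t &
    forall k l2 L2 k2 d, decode_params l1 L1 k1 l2 L2 k2 d < 2 ^ k ->
    KC U (bits L2 (count_by U l2 t %/ 2 ^ k2 + d)) (bits L1 v) <= c + 2 * k.
Proof.
move=> hU; have CC := computable_count_by U; have CB := computable_bits_num.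
pose ix n i := iter i p2 (p1 n).
(* [w] codes [(v, t)]: one search recovers [v] from the condition and finds the stage. The test
   involves no parameter from [l2] on, so [w] can be fixed before them. *)
pose P L1 (y : nat) l1 k1 w := [&& bits_num L1 (p1 w) == y, p1 w < 2 ^ L1 &
  p1 w * 2 ^ k1 <= count_by U l1 (p2 w)].
pose test n w := P (p1 (ix n 2)) (p2 (p2 n)) (p1 (ix n 1)) (p1 (ix n 3)) w.
pose g n w := bits_num (p1 (ix n 5))
  (count_by U (p1 (ix n 4)) (p2 w) %/ 2 ^ p1 (ix n 6) + ix n 7).
have [||c Hc] := @universal_search U hU test g.
- by rewrite /test /P /ix; cbn [iter]; computability.
- by rewrite /g /ix; cbn [iter]; computability.
exists c => l1 L1 k1 v t0 vL H0.
have ex : exists w, P L1 (num (bits L1 v)) l1 k1 w.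
  by exists (pr v t0); rewrite /P !prE num_bits eqxx vL.
case: (ex_minnP ex) => w Pw minw; have /and3P[/eqP Ew wL Hw] := Pw.
have {Ew wL} Ew : p1 w = v.
  by apply: (@bits_inj L1) => //; apply: num_inj; rewrite num_bits.
rewrite Ew in Hw; exists (p2 w) => // k l2 L2 k2 d bk.
have p1b : p1 (decode_params l1 L1 k1 l2 L2 k2 d) = 0.
  by rewrite /decode_params prE.
set x := bits L2 _; set y := bits L1 v in Pw minw *.
have testE w' : test (pr (decode_params l1 L1 k1 l2 L2 k2 d) (pr 0 (num y))) w' =
    P L1 (num y) l1 k1 w' by rewrite /test /ix /decode_params /= !prE.
have := Hc k _ 0 y w x bk; rewrite p1b addn0 testE => /(_ isT Pw) [].
- by move=> w'; rewrite testE; apply: contraL => /minw; rewrite -leqNgt.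
- by rewrite /x num_bits /g /ix /decode_params /= !prE.
- by move=> p sp Hp; apply: leq_trans (KC_le_size Hp) sp.
Qed.

(** * Parameter sizes and the logarithmic bound *)

Lemma pr_exp_bound_le e e' a b :
  e <= e' -> a <= 2 ^ e -> b <= 2 ^ e' -> pr a b <= 2 ^ (2 * e' + 3).
Proof.
move=> ee' Ha; apply: pr_exp_bound; apply: leq_trans Ha _.
by rewrite leq_exp2l.
Qed.

(** Each of the five pairings doubles the exponent and adds [3]; strictness costs one more. *)
Lemma params_ltn_exp p S l1 e f g l2 :
  S <= 2 ^ p -> l1 <= 2 ^ p -> e <= 2 ^ p -> f <= 2 ^ p -> g <= 2 ^ p ->
  l2 <= 2 ^ p -> params S l1 e f g l2 < 2 ^ (32 * p + 94).
Proof.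
move=> HS H1 He Hf Hg H2; apply: (@leq_ltn_trans (2 ^ (32 * p + 93))); last first.
  by rewrite ltn_exp2l //; lia.
rewrite (_ : 32 * p + 93 = 2 * (2 * (2 * (2 * (2 * p + 3) + 3) + 3) + 3) + 3);
  last by lia.
by do ?[apply: (@pr_exp_bound_le p); [lia | by [] | ]].
Qed.

Lemma decode_params_ltn_exp p m l1 L1 k1 l2 L2 k2 d : p <= m ->
  l1 <= 2 ^ p -> L1 <= 2 ^ p -> k1 <= 2 ^ p -> l2 <= 2 ^ p -> L2 <= 2 ^ p ->
  k2 <= 2 ^ p -> d <= 2 ^ m ->
  decode_params l1 L1 k1 l2 L2 k2 d < 2 ^ (128 * m + 382).
Proof.
move=> pm H1 HL1 Hk1 H2 HL2 Hk2 Hd.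
apply: (@leq_ltn_trans (2 ^ (128 * m + 381))); last first.
  by rewrite ltn_exp2l //; lia.
rewrite (_ : 128 * m + 381 = 2 * (2 * (2 * (2 * (2 * (2 * (2 * m + 3) + 3) + 3)
  + 3) + 3) + 3) + 3); last by lia.
by do ?[apply: (@pr_exp_bound_le p); [lia | by [] | ]].
Qed.

Lemma KC_Ncount_bits_bound U : universal_prefix_machine U ->
  exists A B, forall l i, i <= l -> i <= size (binary (Ncount U l)) ->
    let p := (trunc_log 2 l).+1 in
    KC U (binary (Ncount U i)) (take i (binary (Ncount U l))) <= A * p + B /\
    KC U (take i (binary (Ncount U l))) (binary (Ncount U i)) <= A * p + B.
Proof.
move=> hU; have [cA HA] := late_arrivals_bound hU.
have [cB HB] := leading_bits_determined hU; have [c Hc] := KC_count_by hU.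
(* As [l.+1 <= 2 ^ p], the headers used with [HA] and [HB] have [32 * p + 94] bits. Then [2 ^ m]
   bounds either correction, and the header used with [Hc] has [128 * m + 382] bits. *)
exists (256 * 64), (c + 764 + 256 * (cA + cB + 191)) => l i il iL p.
have lp : l.+1 <= 2 ^ p by apply: trunc_log_ltn.
set m := cA + cB + 191 + 64 * p.
have -> : (256 * 64) * p + (c + 764 + 256 * (cA + cB + 191)) = c + 2 * (128 * m + 382).
  by rewrite /m; lia.
have pm : p <= m by rewrite /m; lia.
rewrite take_binary // [binary (Ncount U i)]binaryE -size_binary.
set Nl := Ncount U l; set Ni := Ncount U i; set L := size (binary Nl) in iL *.
set Li := size (binary Ni).
have Ll : L <= l.+1 by apply: size_binary_Ncount.
have Lil : Li <= l.+1 by apply: leq_trans (size_binary_Ncount i hU) _.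
have NlL : Nl < 2 ^ L by apply: ltn_exp_size_binary.
have NiL : Ni < 2 ^ Li by apply: ltn_exp_size_binary.
have vi : Nl %/ 2 ^ (L - i) < 2 ^ i.
  by rewrite ltn_divLR ?expn_gt0 // -expnD subnKC.
have [taul [_ El _]] := enumerated_limit l hU.
have [taui [_ Ei _]] := enumerated_limit i hU.
split.
(* The stage comes from the leading bits of [Ncount U l]; the correction is the number of late
   arrivals for [i]. *)
- have [|t Ht Kt] := Hc l i (L - i) (Nl %/ 2 ^ (L - i)) taul vi.
    by rewrite -El; apply: leq_trunc_div.
  have late : Ni <= count_by U i t + 2 ^ (cA + 2 * (32 * p + 94) + 3).
    by apply: (HA _ _ _ _ _ _ il Ll iL Ht); apply: params_ltn_exp; lia.
  have ci : count_by U i t <= Ni by apply: count_by_leq_Ncount.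
  have := Kt (128 * m + 382) i Li 0 (Ni - count_by U i t).
  rewrite expn0 divn1 subnKC //; apply.
  apply: (decode_params_ltn_exp pm); try lia.
  rewrite leq_subLR; apply: leq_trans late _.
  by rewrite leq_add2l leq_exp2l // /m; lia.
(* The stage comes from [Ncount U i]; the correction is the gap between the leading parts. *)
- have [|t Ht Kt] := Hc i Li 0 Ni taui NiL.
    by rewrite expn0 muln1 -Ei.
  rewrite expn0 muln1 in Ht.
  have lead : Nl %/ 2 ^ (L - i) <=
      count_by U l t %/ 2 ^ (L - i) + 2 ^ (cB + 2 * (32 * p + 94)).
    by apply: (HB _ _ _ _ _ _ iL NlL Ht); apply: params_ltn_exp; lia.
  have cl : count_by U l t %/ 2 ^ (L - i) <= Nl %/ 2 ^ (L - i).
    by apply/leq_div2r/count_by_leq_Ncount.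
  have := Kt (128 * m + 382) l i (L - i)
    (Nl %/ 2 ^ (L - i) - count_by U l t %/ 2 ^ (L - i)).
  rewrite subnKC //; apply.
  apply: (decode_params_ltn_exp pm); try lia.
  rewrite leq_subLR; apply: leq_trans lead _.
  by rewrite leq_add2l leq_exp2l // /m; lia.
Qed.

Lemma trunc_log_Rlog l : 2 <= l -> (INR (trunc_log 2 l) <= Rlog 2 (INR l))%coqR.
Proof.
move=> l2; have ln2 : (0 < ln 2)%coqR by rewrite -ln_1; apply: ln_increasing; lra.
apply: (Rmult_le_reg_r (ln 2)) => //.
rewrite /Rlog /Rdiv Rmult_assoc Rinv_l ?Rmult_1_r; last by lra.
rewrite -ln_pow; last by lra.
have -> : pow 2 (trunc_log 2 l) = INR (2 ^ trunc_log 2 l).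
  elim: (trunc_log 2 l) => [|k IH] //=.
  by rewrite expnS mult_INR -IH.
have pos : (0 < INR (2 ^ trunc_log 2 l))%coqR.
  by apply/lt_0_INR/ltP; rewrite expn_gt0.
have : (INR (2 ^ trunc_log 2 l) <= INR l)%coqR.
  by apply/le_INR/leP/trunc_logP => //; lia.
by case=> [lt|->]; [left; apply: ln_increasing | right].
Qed.

Theorem mainTheorem10 (U : code) (hU : universal_prefix_machine U) :
  exists C : R, forall l i : nat,
    2 <= l -> i <= l -> i <= size (binary (Ncount U l)) ->
    (INR (KC U (binary (Ncount U i)) (take i (binary (Ncount U l))))
       <= C * Rlog 2 (INR l))%coqR /\
    (INR (KC U (take i (binary (Ncount U l))) (binary (Ncount U i)))
       <= C * Rlog 2 (INR l))%coqR.
Proof.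
have [A [B H]] := KC_Ncount_bits_bound hU.
(* With [t = trunc_log 2 l], which is positive for [l >= 2], the additive terms are absorbed:
   [A * (t + 1) + B <= (2 * A + B) * t]. *)
exists (INR (2 * A + B)) => l i l2 il iL.
have real_bound n : n <= A * (trunc_log 2 l).+1 + B ->
    (INR n <= INR (2 * A + B) * Rlog 2 (INR l))%coqR.
  move=> nAB; have tl := trunc_log_Rlog l2.
  have t1 : 1 <= trunc_log 2 l by rewrite trunc_log_gt0.
  apply: (@Rle_trans _ (INR ((2 * A + B) * trunc_log 2 l))).
    by apply/le_INR/leP; apply: leq_trans nAB _; nia.
  by rewrite mult_INR; apply: Rmult_le_compat_l tl; apply: pos_INR.
by have [H1 H2] := H l i il iL; split; apply: real_bound.
Qed.
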